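(* Let $R$ be a multiplicative hyperring and let $I$ be a proper hyperideal of $R$. Then the following are equivalent: (i) $I$ is a quasi $J$-prime hyperideal of $R$. (ii) For all hyperideals $H$ and $T$ of $R$, if $H\circ T\subseteq I$, then $H\subseteq J(R)$ or $T\subseteq\sqrt{I}$. (iii) For all $x,y\in R$, if $x\circ y\subseteq I$, then $x\in J(R)$ or $y\in\sqrt{I}$.
   Context: A multiplicative hyperring is a nonempty set $R$ with an operation $+$ and a hyperoperation $\circ: R\times R\to P^*(R)$ (where $P^*(R)$ is the set of nonempty subsets of $R$) such that: $(R,+)$ is an abelian group; $\circ$ is associative; $a\circ(b+c)\subseteq a\circ b+a\circ c$ and $(b+c)\circ a\subseteq b\circ a+c\circ a$; and $a\circ(-b)=(-a)\circ b=-(a\circ b)$ for all $a,b,c\in R$. For nonempty subsets $A,B\subseteq R$, $A\circ B=\bigcup_{x\in A,\,y\in B}x\circ y$, and $A\circ r=A\circ\{r\}$. Standing assumptions: $R$ is commutative with an identity $1$, meaning $a\in a\circ 1$ for all $a\in R$. A hyperideal of $R$ is a nonempty subset $I\subseteq R$ with $a-b\in I$ for $a,b\in I$ and $r\circ x\subseteq I$ for $x\in I$, $r\in R$. Let $\mathbf{C}=\{r_1\circ r_2\circ\cdots\circ r_n : r_i\in R,\ n\in\mathbb{N}\}$; a hyperideal $I$ is a $\mathbf{C}$-hyperideal if for every $A\in\mathbf{C}$, $A\cap I\neq\varnothing$ implies $A\subseteq I$. Standing assumption: all hyperideals are $\mathbf{C}$-hyperideals. A proper hyperideal $M$ is maximal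 if every hyperideal $N$ with $M\subsetneq N\subseteq R$ equals $R$; the Jacobson radical $J(R)$ is the intersection of all maximal hyperideals of $R$. A proper hyperideal $P$ is prime if $x\circ y\subseteq P$ with $x,y\in R$ implies $x\in P$ or $y\in P$. $\sqrt{I}$ is the intersection of all prime hyperideals of $R$ containing $I$ (and $\sqrt{I}=R$ if there are none). A proper hyperideal $I$ is $J$-prime if for all $x,y\in R$, $x\circ y\subseteq I$ implies $x\in J(R)$ or $y\in I$. A proper hyperideal $I$ is quasi $J$-prime if $\sqrt{I}$ is $J$-prime. *)

(* Defs.v *)
From HB Require Import structures.
From mathcomp Require Import all_boot all_order all_algebra.
From mathcomp Require Import mathcomp_extra boolp classical_sets.

Set Implicit Arguments.
Unset Strict Implicit.
Unset Printing Implicit Defensive.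

Import GRing.Theory.

Local Open Scope classical_set_scope.
Local Open Scope ring_scope.

Definition hmul_set (R : Type) (op : R -> R -> set R) (A B : set R) : set R :=
  \bigcup_(x in A) \bigcup_(y in B) op x y.

Definition add_set (R : zmodType) (A B : set R) : set R :=
  [set a + b | a in A & b in B].

Definition opp_set (R : zmodType) (A : set R) : set R := [set - a | a in A].

HB.mixin Record Zmodule_isMulHyperring R of GRing.Zmodule R := {
  hmul : R -> R -> set R;
  hmul_nonempty : forall a b : R, hmul a b !=set0;
  hmulA : forall a b c : R,
    hmul_set hmul [set a] (hmul b c) = hmul_set hmul (hmul a b) [set c];
  hmulDr : forall a b c : R,
    hmul a (b + c) `<=` add_set (hmul a b) (hmul a c);
  hmulDl : forall a b c : R,
    hmul (b + c) a `<=` add_set (hmul b a) (hmul c a);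
  hmulrN : forall a b : R, hmul a (- b) = opp_set (hmul a b);
  hmulNr : forall a b : R, hmul (- a) b = opp_set (hmul a b)
}.

#[short(type="mulHyperringType")]
HB.structure Definition MulHyperring :=
  {R of GRing.Zmodule R & Zmodule_isMulHyperring R}.

(* The identity is only required to satisfy a \in a o 1, not a o 1 = {a}. *)
HB.mixin Record MulHyperring_isComUnital R of MulHyperring R := {
  hone : R;
  hmulC : forall a b : R, hmul a b = hmul b a;
  hmul1 : forall a : R, hmul a hone a
}.

#[short(type="comMulHyperringType")]
HB.structure Definition ComMulHyperring :=
  {R of MulHyperring R & MulHyperring_isComUnital R}.

Section Hyperideals.
Variable R : comMulHyperringType.
Implicit Types (I P M N A B : set R).

Definition hmuls A B : set R := hmul_set hmul A B.

Definition hyperideal I : Prop :=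
  [/\ I !=set0,
      forall a b, I a -> I b -> I (a - b)
    & forall r x, I x -> hmul r x `<=` I].

(* The finite hyperproducts r_1 o r_2 o ... o r_n with n >= 1, where
   hprod r [:: r_2; ...; r_n] has first factor r; for n = 1 it is {r_1}. *)
Definition hprod (r : R) (s : seq R) : set R :=
  foldl (fun A x => hmuls A [set x]) [set r] s.

Definition hprods : set (set R) :=
  [set A | exists (r : R) (s : seq R), A = hprod r s].

Definition C_hyperideal I : Prop :=
  hyperideal I /\ forall A, hprods A -> A `&` I !=set0 -> A `<=` I.

Definition proper_hyperideal I : Prop := hyperideal I /\ I <> [set: R].

Definition maximal_hyperideal M : Prop :=
  proper_hyperideal M /\ forall N, hyperideal N -> M `<` N -> N = [set: R].

Definition prime_hyperideal P : Prop :=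
  proper_hyperideal P /\ forall x y, hmul x y `<=` P -> P x \/ P y.

(* In the next two definitions an empty intersection is the whole of R. *)
Definition jacobson : set R := \bigcap_(M in maximal_hyperideal) M.

Definition hradical I : set R :=
  \bigcap_(P in [set P | prime_hyperideal P /\ I `<=` P]) P.

Definition J_prime I : Prop :=
  proper_hyperideal I /\ forall x y, hmul x y `<=` I -> jacobson x \/ I y.

Definition quasi_J_prime I : Prop :=
  proper_hyperideal I /\ J_prime (hradical I).

End Hyperideals.

Arguments jacobson R : clear implicits.

(* Main.v *)
Require Import Defs.
From mathcomp Require Import all_boot all_order all_algebra.
From mathcomp Require Import mathcomp_extra boolp classical_sets.

(** Two facts carry the proof.

    For a hyperideal [K] and any subset [A], the residual [K : A], the set of
    all [t] with [A o t] inside [K], is a hyperideal (lemma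
    [residual_hyperideal]).  Residuals replace generated hyperideals: if [x o y] lies in [I], then
    [H := I : y] and [T := I : H] contain [x] and [y] and satisfy
    [H o T <= I], which is how (ii) gives (iii); and adding an element [x] to a
    maximal object [M] is done by passing from [M] to [M : y] with
    [x o y <= M].  Thus maximal hyperideals are prime ([maximal_prime]), and so
    are the hyperideals that are maximal among those containing no power of a
    fixed element.

    The second fact is that an element of the radical of [I] has a power inside
    [I] ([hradical_pow]), obtained from Zorn's lemma and the last remark.  For
    (iii) implies (i), let [x o y] lie in the radical and pick [z] in [x o y].
    Some [z ^ n] lies in [I]; since it is contained in the finite hyperproduct
    [x ^ n o y ^ n], that hyperproduct meets [I], so the C-property puts all of
    it in [I].  Applying (iii) to some [a] in [x ^ n] and [b] in [y ^ n] gives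
    that [a] is in the Jacobson radical or [b] in the radical of [I].  Both are
    intersections of prime hyperideals, and a prime hyperideal meeting the
    powers of an element contains that element ([prime_pow]).  The radical of
    [I] is proper because [1] belongs to each of its own powers. *)

Set Implicit Arguments.
Unset Strict Implicit.
Unset Printing Implicit Defensive.

Import GRing.Theory.

Local Open Scope classical_set_scope.

(** * Products of subsets *)

Section SetProducts.
Variable R : comMulHyperringType.
Implicit Types (A B C K : set R) (x y z a b c : R).

Lemma hmulsP A B c :
  hmuls A B c <-> exists a b, [/\ A a, B b & hmul a b c].
Proof.
split; first by move=> [a Aa [b Bb abc]]; exists a, b.
by move=> [a [b [Aa Bb abc]]]; exists a => //; exists b.
Qed.

Lemma hmuls11 a b : hmuls [set a] [set b] = hmul a b.
Proof. by rewrite /hmuls /hmul_set !bigcup_set1. Qed.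

Lemma hmulsS A A' B B' :
  A `<=` A' -> B `<=` B' -> hmuls A B `<=` hmuls A' B'.
Proof.
move=> sA sB c /hmulsP[a [b [/sA Aa /sB Bb abc]]].
by apply/hmulsP; exists a, b.
Qed.

Lemma hmulsC A B : hmuls A B = hmuls B A.
Proof.
by apply/seteqP; split=> c /hmulsP[a [b [Aa Bb abc]]]; apply/hmulsP;
  exists b, a; split=> //; rewrite hmulC.
Qed.

Lemma hmulsA A B C : hmuls A (hmuls B C) = hmuls (hmuls A B) C.
Proof.
apply/seteqP; split=> d /hmulsP[].
- move=> a [e [Aa /hmulsP[b [c [Bb Cc bce]]] aed]].
  have : hmul_set hmul [set a] (hmul b c) d by exists a => //; exists e.
  rewrite hmulA => -[f abf [_ -> fcd]].
  by exists f; [apply/hmulsP; exists a, b | exists c].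
- move=> e [c [/hmulsP[a [b [Aa Bb abe]]] Cc ecd]].
  have : hmul_set hmul (hmul a b) [set c] d by exists e => //; exists c.
  rewrite -hmulA => -[_ -> [f bcf afd]].
  by exists a => //; exists f => //; apply/hmulsP; exists b, c.
Qed.

Lemma hmulsACA A B C D :
  hmuls (hmuls A B) (hmuls C D) = hmuls (hmuls A C) (hmuls B D).
Proof. by rewrite -!hmulsA (hmulsA B) (hmulsC B) -hmulsA. Qed.

Lemma hmuls_neq0 A B : A !=set0 -> B !=set0 -> hmuls A B !=set0.
Proof.
move=> [a Aa] [b Bb]; have [c abc] := hmul_nonempty a b.
by exists c; apply/hmulsP; exists a, b.
Qed.

Lemma hprod_rcons x s y : hprod x (rcons s y) = hmuls (hprod x s) [set y].
Proof. by rewrite /hprod foldl_rcons. Qed.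

Lemma hprod_neq0 x s : hprod x s !=set0.
Proof.
elim/last_ind: s => [|s y IH]; first by exists x.
by rewrite hprod_rcons; apply: hmuls_neq0 => //; exists y.
Qed.

Lemma hmuls_hprod x s y t :
  hmuls (hprod x s) (hprod y t) = hprod x (s ++ y :: t).
Proof.
elim/last_ind: t => [|t z IH]; first by rewrite cats1 hprod_rcons.
by rewrite -rcons_cons -rcons_cat !hprod_rcons hmulsA IH.
Qed.

(** The power [x ^ (n + 1)]: hyperproducts have at least one factor, so the
    exponent is shifted by one. *)
Definition hpow x n : set R := hprod x (nseq n x).

Lemma hpowS x n : hpow x n.+1 = hmuls (hpow x n) [set x].
Proof. by rewrite /hpow -[n.+1]addn1 nseqD cats1 hprod_rcons. Qed.

Lemma hpowD x m n : hmuls (hpow x m) (hpow x n) = hpow x (m + n.+1).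
Proof. by rewrite /hpow hmuls_hprod nseqD. Qed.

Lemma hpow_hmul x y z n :
  hmul x y z -> hpow z n `<=` hmuls (hpow x n) (hpow y n).
Proof.
move=> xyz; elim: n => [|n IH].
  by move=> _ ->; rewrite /hpow /hprod /= hmuls11.
rewrite !hpowS hmulsACA; apply: hmulsS => // _ ->.
by rewrite hmuls11.
Qed.

Lemma hpow1 n : hpow hone n (hone : R).
Proof.
elim: n => [//|n IH]; rewrite hpowS; apply/hmulsP.
by exists hone, hone; split=> //; exact: hmul1.
Qed.

End SetProducts.

(** * Residuals and maximal hyperideals *)

Section Hyperideals.
Variable R : comMulHyperringType.
Implicit Types (I K P M A : set R) (x y r : R).

Lemma hyperideal0 K : hyperideal K -> K 0%R.
Proof. by case=> -[a Ka] KB _; rewrite -(subrr a); exact: KB. Qed.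

Lemma hyperideal_mulr K a x : hyperideal K -> K a -> hmul a x `<=` K.
Proof. by case=> _ _ KM Ka; rewrite hmulC; exact: KM. Qed.

Lemma hyperideal_one K : hyperideal K -> K hone -> K = [set: R].
Proof.
case=> _ _ KM K1; apply/seteqP; split=> // a _.
exact: (KM a hone K1 a (hmul1 a)).
Qed.

Definition residual K A : set R := [set t | hmuls A [set t] `<=` K].

Lemma residualP K A t :
  residual K A t <-> forall a, A a -> hmul a t `<=` K.
Proof.
split=> [h a Aa c atc|h c /hmulsP[a [_ [Aa -> atc]]]]; last exact: h atc.
by apply: h; apply/hmulsP; exists a, t.
Qed.

Lemma sub_residual K A : hyperideal K -> K `<=` residual K A.
Proof. by move=> [_ _ KM] t Kt; apply/residualP => a _; exact: KM. Qed.

(** Closure under subtraction needs only the inclusion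
    [a o (s - t) <= a o s - a o t]; closure under multiplication comes from
    [A o (r o t) = (A o t) o r]. *)
Lemma residual_hyperideal K A : hyperideal K -> hyperideal (residual K A).
Proof.
move=> hK; have [_ KB KM] := hK; split.
- by exists 0%R; apply: sub_residual => //; exact: hyperideal0.
- move=> s t /residualP hs /residualP ht; apply/residualP => a Aa c ac.
  have [u us [v vt <-]] := hmulDr _ _ _ _ ac.
  have := vt; rewrite hmulrN => -[w wt <-].
  by apply: KB; [exact: hs us | exact: ht wt].
- move=> r t ht s rts; rewrite /residual /=.
  apply: (@subset_trans _ (hmuls A (hmuls [set r] [set t]))).
    by apply: hmulsS => // _ ->; rewrite hmuls11.
  rewrite (hmulsC [set r]) hmulsA => c /hmulsP[d [_ [/ht Kd -> drc]]].
  exact: hyperideal_mulr drc.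
Qed.

(** If [x o y] lies in [M] and [x] does not, then [M : y] is strictly larger
    than [M], hence contains [1], that is, [y] belongs to [M]. *)
Lemma maximal_prime M : maximal_hyperideal M -> prime_hyperideal M.
Proof.
move=> [[hM pM] maxM]; split=> // x y xyM.
have [Mx|nMx] := pselect (M x); [by left | right].
have eT : residual M [set y] = [set: R].
  apply: maxM; first exact: residual_hyperideal.
  split; last by move=> h; apply: nMx; apply: h; apply/residualP => _ ->;
    rewrite hmulC.
  exact: sub_residual.
have /residualP h : residual M [set y] hone by rewrite eT.
exact: (h y erefl y (hmul1 y)).
Qed.

Lemma sub_hradical I : I `<=` hradical I.
Proof. by move=> a Ia P [_ IP]; exact: IP. Qed.

Lemma hradical_hyperideal I : hyperideal I -> hyperideal (hradical I).
Proof.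
move=> hI; split.
- by exists 0%R; apply: sub_hradical; exact: hyperideal0.
- move=> a b ra rb P PI; have [[[[_ PB _] _] _] _] := PI.
  by apply: PB; [exact: ra | exact: rb].
- move=> r x rx c rxc P PI; have [[[[_ _ PM] _] _] _] := PI.
  by apply: PM rxc; exact: rx.
Qed.

(** * Powers and prime hyperideals *)

Lemma hprod_sub K x s a :
  C_hyperideal K -> hprod x s a -> K a -> hprod x s `<=` K.
Proof. by move=> [_ CK] xa Ka; apply: CK; [exists x, s | exists a]. Qed.

(** Primality alone splits a product only when all of it lies in [P]; the
    C-property upgrades a common element of [b o x] and [P] to an inclusion. *)
Lemma prime_pow P x n a :
  C_hyperideal P -> prime_hyperideal P -> hpow x n a -> P a -> P x.
Proof.
move=> CP [_ prP]; elim: n a => [a -> //|n IH a].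
rewrite hpowS => /hmulsP[b [_ [xb -> bxa]]] Pa.
have bxE : hprod b [:: x] = hmul b x by rewrite /hprod /= hmuls11.
have /prP[Pb|//] : hmul b x `<=` P.
  by rewrite -bxE; apply: (@hprod_sub _ _ _ a) => //; rewrite bxE.
exact: IH xb Pb.
Qed.

Definition avoids_powers r K : Prop := forall n, ~ (hpow r n `<=` K).

(** If neither [x] nor [y] is in [P] but [x o y] is, then [P : y] contains some
    [r ^ m]; so [P : r ^ m] contains [y], and therefore also some [r ^ n].
    Then [r ^ m o r ^ n] is a power of [r] inside [P]. *)
Lemma maximal_avoiding_prime r P :
  hyperideal P -> avoids_powers r P ->
  (forall K, hyperideal K -> P `<` K -> ~ avoids_powers r K) ->
  prime_hyperideal P.
Proof.
move=> hP avP maxP.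
have residual_pow A t : residual P A t -> ~ P t ->
    exists n, hpow r n `<=` residual P A.
  move=> At nPt; apply: contrapT => noP.
  apply: (maxP (residual P A)); first exact: residual_hyperideal.
    by split; [exact: sub_residual | move=> h; apply/nPt/h].
  by move=> n h; apply: noP; exists n.
split=> [|x y xyP]; first by split=> // PT; apply: (avP 0); rewrite PT.
have [Px|nPx] := pselect (P x); [by left | right].
apply: contrapT => nPy.
have [m hm] : exists m, hpow r m `<=` residual P [set y].
  by apply: (residual_pow _ x) => //; apply/residualP => _ ->; rewrite hmulC.
have [n hn] : exists n, hpow r n `<=` residual P (hpow r m).
  apply: (residual_pow _ y) => //; apply/residualP => a /hm/residualP.
  by rewrite hmulC; apply.
apply: (avP (m + n.+1)%N); rewrite -hpowD => c /hmulsP[a [b [ra rb abc]]].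
by have /residualP/(_ a ra) := hn b rb; apply.
Qed.

Lemma chain_union_hyperideal (F : set (set R)) :
  F !=set0 -> total_on F subset -> (forall K, F K -> hyperideal K) ->
  hyperideal (\bigcup_(K in F) K).
Proof.
move=> [K0 FK0] tot hF; split.
- by exists 0%R; exists K0 => //; exact: hyperideal0 (hF _ FK0).
- move=> a b [K FK Ka] [L FL Lb]; have [KL|LK] := tot K L FK FL.
    by exists L => //; have [_ LB _] := hF L FL; apply: LB => //; exact: KL.
  by exists K => //; have [_ KB _] := hF K FK; apply: KB => //; exact: LK.
- move=> s x [K FK Kx] c sxc; exists K => //.
  by have [_ _ KM] := hF K FK; exact: KM sxc.
Qed.

(** If no power of [r] lay in [I], a hyperideal maximal among those that contain
    [I] and no power of [r] would be prime, and would then contain [r] itself.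
    Zorn's lemma provides one: a power of [r] inside the union of a chain meets,
    hence by the C-property lies inside, one member of the chain. *)
Lemma hradical_pow I r :
  (forall K, hyperideal K -> C_hyperideal K) ->
  hyperideal I -> hradical I r -> exists n, hpow r n `<=` I.
Proof.
move=> hC hI rI; apply: contrapT => noI.
pose good K := [/\ hyperideal K, I `<=` K & avoids_powers r K].
have goodI : good I by split=> // n h; apply: noI; exists n.
(* The empty set is admitted because it is the union of the empty chain. *)
have [F FP tot|P [goodP maxP]] :=
    @Zorn_bigcup R [set K | K = set0 \/ good K].
  pose G := [set K | F K /\ good K].
  have -> : \bigcup_(K in F) K = \bigcup_(K in G) K.
    apply/seteqP; split=> a [K]; last by move=> [FK _] Ka; exists K.
    move=> FK Ka; exists K => //; split=> //.
    by have [K0|//] := FP K FK; move: Ka; rewrite K0.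
  have [[K [FK gK]]|G0] := pselect (G !=set0); last first.
    by left; apply/seteqP; split=> // a [K GK _]; apply: G0; exists K.
  right; split.
  - apply: chain_union_hyperideal; first by exists K.
      by move=> A B [FA _] [FB _]; exact: (tot A B FA FB).
    by move=> L [_ []].
  - by have [_ IK _] := gK; move=> a /IK Ka; exists K.
  - move=> n h; have [a ra] := hprod_neq0 r (nseq n r).
    have [L [_ [hL _ avL]] La] := h a ra.
    by apply: (avL n); apply: (@hprod_sub _ _ _ a) => //; exact: hC.
have [hP IP avP] : good P.
  case: goodP => // P0; exfalso; apply: (maxP I); last by right.
  rewrite P0; split=> // I0.
  by have := I0 _ (hyperideal0 hI).
have prP : prime_hyperideal P.
  apply: (@maximal_avoiding_prime r) => // K hK PK avK.
  apply: (maxP K PK); right; split=> //.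
  by apply: subset_trans IP _; case: PK.
by apply: (avP 0) => _ ->; exact: rI.
Qed.

Lemma hradical_proper I :
  (forall K, hyperideal K -> C_hyperideal K) ->
  proper_hyperideal I -> proper_hyperideal (hradical I).
Proof.
move=> hC [hI pI]; split=> [|radT]; first exact: hradical_hyperideal.
have [n nI] : exists n, hpow hone n `<=` I by apply: hradical_pow; rewrite ?radT.
by apply: pI; apply: hyperideal_one => //; apply: nI; exact: hpow1.
Qed.

End Hyperideals.

(** * The characterization *)

Theorem theorem4p4 (R : comMulHyperringType)
    (hC : forall K : set R, hyperideal K -> C_hyperideal K)
    (I : set R) (hI : proper_hyperideal I) :
  [<-> quasi_J_prime I;
       forall H T : set R, hyperideal H -> hyperideal T ->
         hmuls H T `<=` I -> H `<=` jacobson R \/ T `<=` hradical I;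
       forall x y : R, hmul x y `<=` I -> jacobson R x \/ hradical I y].
Proof.
have [idI _] := hI.
tfae.
- move=> [_ [_ Jp]] H T _ _ HTI.
  have [HJ|/existsNP[h /not_implyP[Hh nJh]]] := pselect (H `<=` jacobson R).
    by left.
  right=> t Tt; have /Jp[//|//] : hmul h t `<=` hradical I.
  move=> c htc; apply: sub_hradical; apply: HTI.
  by apply/hmulsP; exists h, t.
- move=> idJ x y xyI.
  pose H := residual I [set y]; pose T := residual I H.
  have Hx : H x by apply/residualP => _ ->; rewrite hmulC.
  have Ty : T y.
    by apply/residualP => a /residualP/(_ y erefl); rewrite hmulC.
  have [||c /hmulsP[a [b [Ha /residualP Tb abc]]]|HJ|TI] := idJ H T.
  + exact: residual_hyperideal.
  + exact: residual_hyperideal.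
  + exact: Tb abc.
  + by left; exact: HJ.
  + by right; exact: TI.
- move=> eltJ; split=> //; split; first exact: hradical_proper.
  move=> x y xyI.
  have [z xyz] := hmul_nonempty x y.
  have [n znI] := hradical_pow hC idI (xyI z xyz).
  have xnynI : hmuls (hpow x n) (hpow y n) `<=` I.
    have [c zc] := hprod_neq0 z (nseq n z).
    have := hpow_hmul xyz zc; rewrite hmuls_hprod => xyc.
    by apply: hprod_sub xyc _; [exact: hC | exact: znI].
  have [a xa] := hprod_neq0 x (nseq n x).
  have [b yb] := hprod_neq0 y (nseq n y).
  have [c abc|Ja|rb] := eltJ a b.
  + by apply: xnynI; apply/hmulsP; exists a, b.
  + left=> M maxM; have prM := maximal_prime maxM.
    by apply: prime_pow xa _ => //; [apply: hC; case: prM => -[] | exact: Ja].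
  + right=> P PI; have [prP _] := PI.
    by apply: prime_pow yb _ => //; [apply: hC; case: prP => -[] | exact: rb].
Qed.
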